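(* Let $\Delta$ be a nonnegative integer and let $G$ be a multigraph in which every vertex has degree at most $\Delta$. Let $x,y\in V(G)$ be two distinct vertices at finite distance, and let $t=d_G(x,y)\ge 1$. Then $$n_G(x,y)\;\le\;\Delta\cdot\left(\left\lfloor\frac{\Delta}{2}\right\rfloor\left\lceil\frac{\Delta}{2}\right\rceil\right)^{(t-1)/2}.$$
   Context: Multigraphs are undirected and may have parallel edges; the degree of a vertex counts incident edges with multiplicity. $d_G(x,y)$ denotes the graph distance (the number of edges in a shortest path) between $x$ and $y$. $n_G(x,y)$ denotes the number of shortest paths between $x$ and $y$ in $G$, where a path is regarded as the sequence of its vertices and edges $(X_0,E_1,X_1,\ldots,E_t,X_t)$ with $X_0=x$, $X_t=y$, so that paths using different parallel edges are counted as different. The exponent $(t-1)/2$ may be a half-integer (the power is a real power), and $0^0=1$. *)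

(* Defs.v *)
From mathcomp Require Import all_boot all_order all_algebra.
From mathcomp Require Import all_classical all_reals all_analysis.

Set Implicit Arguments.
Unset Strict Implicit.
Unset Printing Implicit Defensive.

Import Order.TTheory GRing.Theory Num.Theory.

Local Open Scope classical_set_scope.
Local Open Scope ring_scope.

(* Vertices and edges may be infinite in number. The order of the two
   components of [ends G e] carries no meaning: the edges are undirected, and
   [incident] and [joins] are symmetric in them. Parallel edges are distinct
   elements of [E] with the same ends. *)
Record multigraph (V E : Type) := Multigraph { ends : E -> V * V }.

Section Multigraph.
Variables (V E : choiceType) (G : multigraph V E).

Definition incident (e : E) (v : V) : Prop :=
  (ends G e).1 = v \/ (ends G e).2 = v.

Definition joins (e : E) (u v : V) : Prop :=
  ends G e = (u, v) \/ ends G e = (v, u).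

(* [counting] is +oo on infinite sets. A loop, if there is any, counts once
   here; so an upper bound on this degree is a weaker assumption than the same
   bound on the degree that counts loops twice. *)
Definition degree (R : realType) (v : V) : \bar R :=
  counting [set e | incident e v].

Fixpoint is_walk (x : V) (p : seq (E * V)) : Prop :=
  if p is (e, v) :: p' then joins e x v /\ is_walk v p' else True.

(* The sequence (X_0, E_1, X_1, ..., E_t, X_t) with X_0 = x is encoded by x
   together with p = [:: (E_1, X_1); ...; (E_t, X_t)]. *)
Definition is_path (x y : V) (p : seq (E * V)) : Prop :=
  [/\ is_walk x p, last x (unzip2 p) = y & uniq (x :: unzip2 p)].

Definition shortest_paths (x y : V) : set (seq (E * V)) :=
  [set p | is_path x y p /\ forall q, is_path x y q -> (size p <= size q)%N].

(* d_G(x, y) = t, with t finite; no t satisfies this when y is not reachable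
   from x. *)
Definition distance_is (x y : V) (t : nat) : Prop :=
  exists2 p, shortest_paths x y p & size p = t.

Definition num_shortest_paths (R : realType) (x y : V) : \bar R :=
  counting (shortest_paths x y).

End Multigraph.

(* Main.v *)
(* Draw a shortest path from x forwards, choosing the next edge uniformly among
   those that continue the part drawn so far to a shortest path, or backwards
   from y in the same way. If w(p) and w'(p) are the two probabilities of p,
   then 1/(w(p) w'(p)) is the product of the numbers of choices. At x and at y
   there are at most Delta of them; at an inner vertex, the c choices forwards
   and the c' choices backwards are disjoint sets of incident edges (a common
   edge would allow a shortcut), so c c' <= floor(Delta/2) ceil(Delta/2). Thus
   b^2 w(p) w'(p) >= 1, where b is the claimed bound, and w(p) + w'(p) >= 2/b
   by AM-GM. Summing over p, both probabilities add up to at most 1. *)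

Require Import Defs.
From mathcomp Require Import all_boot all_order all_algebra.
From mathcomp Require Import all_classical all_reals all_analysis.
From mathcomp Require Import ring zify.

Set Implicit Arguments.
Unset Strict Implicit.
Unset Printing Implicit Defensive.

Import Order.TTheory GRing.Theory Num.Theory.

Local Open Scope ring_scope.

(** * Weighted counting of words of equal length *)

Section Words.
Variable A : eqType.
Implicit Types (S : seq (seq A)) (p r s : seq A) (a : A).

(** The choices open when a word of [S] is drawn backwards and [s] is the part drawn so far; without
    repetitions, so that [size] counts them. *)
Definition left_letters S s : seq A :=
  [seq a <- undup (flatten S) | has (suffix (a :: s)) S].

Definition right_letters S r : seq A := left_letters (map rev S) (rev r).

Lemma left_letters_uniq S s : uniq (left_letters S s).
Proof. exact/filter_uniq/undup_uniq. Qed.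

Lemma left_lettersP S s a :
  reflect (exists r, r ++ a :: s \in S) (a \in left_letters S s).
Proof.
rewrite mem_filter mem_undup; apply: (iffP andP) => [[/hasP[p pS]]|[r rS]].
  by move=> /suffixP[r ep] _; exists r; rewrite -ep.
split; first by apply/hasP; exists (r ++ a :: s); rewrite ?suffix_suffix.
apply/flattenP; exists (r ++ a :: s) => //.
by rewrite mem_cat mem_head orbT.
Qed.

Lemma right_letters_uniq S r : uniq (right_letters S r).
Proof. exact: left_letters_uniq. Qed.

Lemma right_lettersP S r a :
  reflect (exists s, r ++ a :: s \in S) (a \in right_letters S r).
Proof.
apply: (iffP (left_lettersP _ _ _)) => -[s].
  case/mapP=> p pS ep; exists (rev s).
  by rewrite -(revK p) -ep rev_cat rev_cons revK cat_rcons in pS.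
move=> sS; exists (rev s); apply/mapP; exists (r ++ a :: s) => //.
by rewrite rev_cat rev_cons cat_rcons.
Qed.

(* Read backwards, a word is drawn by choosing each of its letters uniformly
   among those available; the summand is a lower bound for the probability of
   the word [p]. *)
Lemma kraft_left (R : realFieldType) (c : seq A -> nat) n S :
    uniq S -> {in S, forall p, size p = n} ->
    (forall s, (size (left_letters S s) <= c s)%N) ->
  \sum_(p <- S) \prod_(i < size p) (c (drop i.+1 p))%:R^-1 <= 1 :> R.
Proof.
elim: n S => [|n IHn] S uS szS cS.
  have sub : {subset S <= [:: [::]]}.
    by move=> p /szS/size0nil ->; rewrite inE.
  case: S uS sub {szS cS} => [|p [|q S]] uS sub; first by rewrite big_nil.
    by have := sub p (mem_head _ _); rewrite inE => /eqP->;
      rewrite big_seq1 big_ord0.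
  have /= := uniq_leq_size uS sub; lia.
(* The first letter is drawn last, so the induction removes it; words with the same tail are
   merged. *)
pose S' := undup (map behead S).
have uS' : uniq S' by apply: undup_uniq.
pose W p : R := \prod_(i < size p) (c (drop i.+1 p))%:R^-1.
rewrite -/(W _).
have W_ge0 p : 0 <= W p by apply: prodr_ge0 => i _; rewrite invr_ge0 ler0n.
apply: (@le_trans _ _ (\sum_(s <- S') W s)); last first.
  apply: IHn => // [p|s].
    by rewrite mem_undup => /mapP[q qS ->]; rewrite size_behead szS.
  apply: leq_trans (cS s); apply: uniq_leq_size (left_letters_uniq _ _) _ => a.
  case/left_lettersP=> r; rewrite mem_undup => /mapP[[|b q] qS /= eq].
    by case: r eq.
  by apply/left_lettersP; exists (b :: r); rewrite /= eq.
have WE p : p \in S -> W p = \sum_(s <- S') if s == behead p then W p else 0.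
  move=> pS; rewrite -big_mkcond -big_filter filter_pred1_uniq ?big_seq1 //.
  by rewrite mem_undup map_f.
rewrite (eq_big_seq _ WE).
rewrite exchange_big; apply: ler_sum => s _.
rewrite -big_mkcond -big_filter /=.
pose F := [seq p <- S | s == behead p].
have FP p : p \in F -> exists2 a, a \in left_letters S s & p = a :: s.
  rewrite mem_filter => /andP[/eqP-> pS]; case: p pS => [/szS//|a p pS].
  by exists a => //; apply/left_lettersP; exists [::].
(* The words with tail [s] all have this weight, and they differ in a left letter of [s], so there
   are at most [c s] of them. *)
rewrite (eq_big_seq (fun=> (c s)%:R^-1 * W s)); last first.
  by move=> p /FP[a _ ->]; rewrite /W /= big_ord_recl /= drop0.
rewrite big_const_seq count_predT iter_addr_0 -mulrnAl -mulr_natl.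
apply: ler_piMl => //.
have szF : (size F <= c s)%N.
  apply: leq_trans (cS s); rewrite -(size_map (cons^~ s)).
  apply: uniq_leq_size; first exact: filter_uniq.
  by move=> p /FP[a aL ->]; apply: map_f.
(* For [c s = 0] the inverse is 0 by convention. *)
have [->|c_gt0] := posnP (c s); first by rewrite invr0 mulr0.
by rewrite ler_pdivrMr ?ltr0n // mul1r ler_nat.
Qed.

(** Reversing all words turns forward drawing into backward drawing, with the factors in opposite
    order. *)
Lemma kraft_right (R : realFieldType) n S :
    uniq S -> {in S, forall p, size p = n} ->
  \sum_(p <- S) \prod_(i < size p) (size (right_letters S (take i p)))%:R^-1
    <= 1 :> R.
Proof.
move=> uS szS.
pose c s := size (left_letters (map rev S) s).
have uS' : uniq (map rev S) by rewrite map_inj_uniq //; exact: (can_inj revK).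
have szS' : {in map rev S, forall p, size p = n}.
  by move=> p /mapP[q qS ->]; rewrite size_rev szS.
apply: le_trans (@kraft_left R c n (map rev S) uS' szS' (fun=> leqnn _)).
rewrite big_map le_eqVlt; apply/orP; left; apply/eqP.
apply: eq_bigr => p _; rewrite size_rev (reindex_inj rev_ord_inj) /=.
apply: eq_bigr => i _; by rewrite /right_letters /c drop_rev.
Qed.

(** With h = floor(d/2) and o = d mod 2, h (h + o) - a (d - a) = (a - h) (a - h - o), which is
    nonnegative because a is an integer and o is 0 or 1. *)
Lemma leq_mul_half_uphalf (a b d : nat) :
  (a + b <= d)%N -> (a * b <= d./2 * uphalf d)%N.
Proof. 
move=> abd; rewrite uphalf_half; have dE := odd_double_half d.
set h := d./2 in dE *; set o : nat := odd d in dE *.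
have o_le1 : (o <= 1)%N by rewrite /o; case: odd.
have ab : (a * b <= a * (o + h.*2 - a))%N by rewrite leq_mul2l; lia.
apply: leq_trans ab _.
have [ah|ha] := leqP a h.
  have -> : (o + h.*2 - a = (h - a) + (h + o))%N by lia.
  have -> : (h * (o + h) = a * (o + h) + (h - a) * (o + h))%N by nia.
  nia.
have [oa|] := leqP a (o + h.*2); last by lia.
have -> : (o + h.*2 - a = h - (a - (h + o)))%N by lia.
nia.
Qed.

(** The counting argument freed from the graph; letters stand for edges. Fixing [b] through its
    square avoids half-integer exponents. *)
Lemma card_words (R : realFieldType) (d t : nat) S (b : R) :
    uniq S -> {in S, forall p, size p = t.+1} ->
    (size (left_letters S [::]) <= d)%N ->
    (size (right_letters S [::]) <= d)%N ->
    (forall p i, p \in S -> (0 < i <= t)%N ->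
      (size (left_letters S (drop i p)) + size (right_letters S (take i p))
         <= d)%N) ->
    0 <= b -> b ^+ 2 = (d ^ 2 * (d./2 * uphalf d) ^ t)%:R ->
  (size S)%:R <= b.
Proof.
move=> uS szS Ld Rd LRd b_ge0 b2.
pose l p i := size (left_letters S (drop i p)).
pose r p i := size (right_letters S (take i p)).
have dropE p i : p \in S -> (i < t.+1)%N ->
    exists a, drop i p = a :: drop i.+1 p.
  move=> /szS; case: p => [//|x p] szp it; exists (nth x (x :: p) i).
  by rewrite (drop_nth x) // szp.
(* The letter of [p] itself is always available, so no inverse below is that of 0. *)
have l_gt0 p i : p \in S -> (i < t.+1)%N -> (0 < l p i.+1)%N.
  move=> pS /(dropE p i pS)[a e]; rewrite lt0n size_eq0; apply/eqP => l0.
  have : a \in left_letters S (drop i.+1 p).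
    by apply/left_lettersP; exists (take i p); rewrite -e cat_take_drop.
  by rewrite l0.
have r_gt0 p i : p \in S -> (i < t.+1)%N -> (0 < r p i)%N.
  move=> pS /(dropE p i pS)[a e]; rewrite lt0n size_eq0; apply/eqP => r0.
  have : a \in right_letters S (take i p).
    by apply/right_lettersP; exists (drop i.+1 p); rewrite -e cat_take_drop.
  by rewrite r0.
pose L p := (\prod_(i < t.+1) l p i.+1)%N.
pose U p := (\prod_(i < t.+1) r p i)%N.
have L_gt0 p : p \in S -> (0 < L p)%N.
  by move=> pS; rewrite prodn_gt0 // => i; apply: l_gt0.
have U_gt0 p : p \in S -> (0 < U p)%N.
  by move=> pS; rewrite prodn_gt0 // => i; apply: r_gt0.
have LU p : p \in S -> (L p * U p <= d ^ 2 * (d./2 * uphalf d) ^ t)%N.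
  (* The backward choice at the end and the forward choice at the start are split off; the other
     factors pair up at the cuts 1, ..., t. *)
  move=> pS; rewrite /L /U big_ord_recr big_ord_recl /=.
  set X := (\prod_(i < t) _)%N; set Y := (\prod_(i < t) _)%N.
  have -> : (X * l p t.+1 * (r p 0 * Y) = l p t.+1 * r p 0 * (X * Y))%N by lia.
  rewrite {}/X {}/Y.
  have -> : l p t.+1 = size (left_letters S [::]).
    by rewrite /l drop_oversize // (szS p).
  have -> : r p 0%N = size (right_letters S [::]) by rewrite /r take0.
  apply: leq_mul; first exact: leq_mul.
  rewrite -big_split /= -[X in (_ ^ X)%N](card_ord t) -prod_nat_const.
  by apply: leq_prod => i _; apply: leq_mul_half_uphalf;
    apply: LRd => //; rewrite ltn_ord.
have AM_GM p : p \in S -> 2 <= b * ((L p)%:R^-1 + (U p)%:R^-1).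
  move=> pS; set x : R := (L p)%:R; set y : R := (U p)%:R.
  have x_gt0 : 0 < x by rewrite ltr0n L_gt0.
  have y_gt0 : 0 < y by rewrite ltr0n U_gt0.
  have xy : x * y <= b ^+ 2 by rewrite b2 -natrM ler_nat LU.
  have xVyV : 1 <= b ^+ 2 * (x^-1 * y^-1).
    by rewrite -invfM ler_pdivlMr ?mulr_gt0 // mul1r.
  (* Comparing squares gives AM-GM without roots. *)
  rewrite -(@ler_sqr _ 2) ?nnegrE ?mulr_ge0 ?addr_ge0 ?invr_ge0 ?ler0n //.
  rewrite exprMn; move: xVyV; move: (x^-1) (y^-1) => u v uv.
  have sq_ge0 := mulr_ge0 (sqr_ge0 b) (sqr_ge0 (u - v)).
  rewrite -subr_ge0.
  have -> : b ^+ 2 * (u + v) ^+ 2 - 2 ^+ 2 =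
    b ^+ 2 * (u - v) ^+ 2 + 4 * (b ^+ 2 * (u * v) - 1) by ring.
  by rewrite addr_ge0 // mulr_ge0 // subr_ge0.
have : \sum_(p <- S) 2 <= b * 2 :> R.
  apply: (@le_trans _ _ (\sum_(p <- S) b * ((L p)%:R^-1 + (U p)%:R^-1))).
    by rewrite !big_seq; apply: ler_sum => p; apply: AM_GM.
  rewrite -mulr_sumr ler_wpM2l // big_split /= [leRHS](_ : _ = 1 + 1) //.
  have prodE (f : nat -> nat) : \prod_(i < t.+1) (f i)%:R^-1 =
      ((\prod_(i < t.+1) f i)%N)%:R^-1 :> R.
    by rewrite natr_prod prodfV.
  apply: lerD.
    pose c s := size (left_letters S s).
    apply: le_trans (@kraft_left R c _ S uS szS (fun=> leqnn _)).
    rewrite [leLHS]big_seq [leRHS]big_seq; apply: ler_sum => p pS.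
    by rewrite szS // -(prodE (fun i => l p i.+1)).
  apply: le_trans (@kraft_right R _ S uS szS) => //.
  rewrite [leLHS]big_seq [leRHS]big_seq; apply: ler_sum => p pS.
  by rewrite szS // -(prodE (r p)).
by rewrite big_const_seq count_predT iter_addr_0 -[_ *+ size S]mulr_natl ler_pM2r ?ltr0n.
Qed.

End Words.

(** * Walks as sequences of edges *)

Section Trails.
Variables (V E : choiceType) (G : multigraph V E).
Implicit Types (x y z u v w : V) (e : E) (s r : seq E) (p q : seq (E * V)).

(** Vertices are left implicit, so that edge sequences can serve as words. *)
Fixpoint trail x s y : Prop :=
  if s is e :: s' then exists2 v, joins G e x v & trail v s' y else x = y.

Lemma joins_incident e u v : joins G e u v -> incident G e u.
Proof. by rewrite /incident; case=> ->; [left|right]. Qed.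

Lemma joins_sym e u v : joins G e u v -> joins G e v u.
Proof. by case; [right|left]. Qed.

Lemma joins_inj e u v w : joins G e u v -> joins G e u w -> v = w.
Proof. by rewrite /joins => -[] -> [] [] // -> ->. Qed.

Lemma trail_cat x s r y :
  trail x (s ++ r) y <-> exists2 z, trail x s z & trail z r y.
Proof.
elim: s x => [|e s IHs] x /=; first by split=> [|[z ->]] //; exists x.
split=> [[v jv /IHs[z vz zy]]|[z [v jv vz] zy]].
  by exists z => //; exists v.
by exists v => //; apply/IHs; exists z.
Qed.

(** Together with [trail_start_inj], this assigns one vertex to a cut: trails sharing the part
    before it, or the part after it, meet there. *)
Lemma trail_end_inj x s y z : trail x s y -> trail x s z -> y = z.
Proof.
elim: s x => [|e s IHs] x /= => [<-//|[v jv vy] [w jw wz]].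
by move: wz; rewrite -(joins_inj jv jw); apply: IHs.
Qed.

Lemma trail_start_inj x y s z : trail x s z -> trail y s z -> x = y.
Proof.
elim: s x y => [|e s IHs] x y /= => [-> ->//|[v jv vz] [w jw wz]].
rewrite -(IHs _ _ vz wz) in jw.
exact: joins_inj (joins_sym jv) (joins_sym jw).
Qed.

Lemma walk_trail x p : is_walk G x p -> trail x (unzip1 p) (last x (unzip2 p)).
Proof.
by elim: p x => [|[e v] p IHp] x //= [jv /IHp vp]; exists v.
Qed.

(** Ensures that no paths are identified when only their edges are kept. *)
Lemma walk_inj x p q :
  is_walk G x p -> is_walk G x q -> unzip1 p = unzip1 q -> p = q.
Proof.
elim: p q x => [|[e v] p IHp] [|[f w] q] x //= [jv wp] [jw wq] [ef pq].
move: jw wq; rewrite -ef => /(joins_inj jv) <- wq.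
by rewrite (IHp q v).
Qed.

Lemma is_walk_drop x p u :
  is_walk G x p -> u \in unzip2 p ->
  exists q, [/\ is_walk G u q, last u (unzip2 q) = last x (unzip2 p),
    (size q <= size p)%N & exists r : seq V, unzip2 p = r ++ u :: unzip2 q].
Proof.
elim: p x => [|[e v] p IHp] x //= [jv wp]; rewrite inE.
have [->|_ /= up] := eqVneq u v.
  by exists p; split=> //; exists [::].
have [q [wq lq szq [r er]]] := IHp v wp up.
by exists q; split=> //; [exact: leqW|exists (v :: r); rewrite er].
Qed.

(* Cutting out the closed parts of a walk leaves a path. *)
Lemma trail_path x s y :
  trail x s y -> exists2 p, is_path G x y p & (size p <= size s)%N.
Proof.
elim: s x => [|e s IHs] x /= => [<-|[v jv /IHs[p [wp lp up] szp]]].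
  by exists [::].
have [xp|xp] := boolP (x \in v :: unzip2 p); last first.
  by exists ((e, v) :: p) => //; split=> //=; apply/andP.
(* The walk returns to [x]; everything before that return is dropped. *)
have wxp : is_walk G x ((e, v) :: p) by [].
have [q [wq lq szq [r er]]] := is_walk_drop wxp xp.
exists q; last exact: leq_trans szq _.
split=> //; first by rewrite lq.
by move: up; rewrite [X in uniq X]er cat_uniq => /and3P[].
Qed.

End Trails.

(** * Bounds on [counting] through finite lists *)

Lemma counting_le_size (R : realType) (T : choiceType) (A : set T) n (s : seq T) :
    (counting A <= n%:R%:E :> \bar R)%E -> uniq s -> {in s, forall a, A a} ->
  (size s <= n)%N.
Proof.
rewrite /counting; case: ifPn => [/asboolP finA|_]; last by rewrite leye_eq.
rewrite lee_fin ler_nat => szA us sA; apply: leq_trans szA.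
apply: uniq_leq_size => // a /sA Aa.
by rewrite in_fset_set // inE.
Qed.

(** An infinite [A] would contain a finite subset with more than [b] elements. *)
Lemma counting_le (R : realType) (T : choiceType) (A : set T) (b : R) :
    (forall s : seq T, uniq s -> {in s, forall a, A a} -> (size s)%:R <= b) ->
  (counting A <= b%:E)%E.
Proof.
move=> sb; rewrite /counting; case: ifPn => [/asboolP finA|/asboolP infA].
  rewrite lee_fin; apply: sb => [|a]; first exact: finmap.fset_uniq.
  by rewrite in_fset_set // inE.
have [B BA szB] := infinite_set_fset (Num.truncn b).+1 infA.
have := sb _ (finmap.fset_uniq B) (fun a aB => BA a aB).
rewrite leNgt => /negP[]; apply: lt_le_trans (truncnS_gt b) _.
by rewrite ler_nat.
Qed.

Theorem theorem1 (R : realType) (Delta : nat) (V E : choiceType)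
    (G : multigraph V E)
    (degG : forall v : V, (degree G R v <= Delta%:R%:E)%E)
    (x y : V) (neq_xy : x <> y) (t : nat) (dist_xy : distance_is G x y t) :
  (num_shortest_paths G R x y <=
    (Delta%:R * ((Delta./2)%:R * (uphalf Delta)%:R) `^ ((t%:R - 1) / 2))%:E)%E.
Proof.
have [p0 [pp0 min0] szp0] := dist_xy.
have min_t s : trail G x s y -> (t <= size s)%N.
  by move=> /trail_path[p pp]; apply: leq_trans; rewrite -szp0 min0.
have [t' et] : exists t', t = t'.+1.
  case: t {dist_xy min_t} szp0 => [/size0nil p0E|t' _]; last by exists t'.
  by case: pp0; rewrite p0E /= => _ /neq_xy.
(* Finiteness of the set of shortest paths is not presupposed: any finite list [P] of them is
   bounded, and choices are counted within [P]. *)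
apply: counting_le => P uP PP.
pose S := map (@unzip1 E V) P.
have PS p : p \in P -> [/\ is_walk G x p, trail G x (unzip1 p) y & size p = t].
  move=> /PP[[wp lp up] minp]; split=> //; first by rewrite -lp; apply: walk_trail.
  by apply/eqP; rewrite -szp0 eqn_leq minp // min0.
have trS s : s \in S -> trail G x s y by case/mapP=> p /PS[_ tp _] ->.
have szS : {in S, forall s, size s = t'.+1}.
  by move=> s /mapP[p /PS[_ _ szp] ->]; rewrite size_map szp.
have uS : uniq S.
  rewrite map_inj_in_uniq // => p q /PS[wp _ _] /PS[wq _ _].
  exact: walk_inj wp wq.
have deg v (s : seq E) :
    uniq s -> {in s, forall e, incident G e v} -> (size s <= Delta)%N.
  exact: counting_le_size (degG v).
rewrite -(size_map (@unzip1 E V)) -/S.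
apply: (card_words uS szS (d := Delta)).
- apply: (deg y); first exact: left_letters_uniq.
  move=> e /left_lettersP[r /trS/trail_cat[z _ [w jw <-]]].
  exact/joins_incident/joins_sym/jw.
- apply: (deg x); first exact: right_letters_uniq.
  by move=> e /right_lettersP[r /trS /= [w /joins_incident]].
- move=> p i pS /andP[i_gt0 it].
  have := trS p pS; rewrite -{1}(cat_take_drop i p) => /trail_cat[z xz zy].
  (* A left letter enters [z] after i - 1 edges from [x]; a right letter leaves [z] with t - 1 - i
     edges still to go to [y]. *)
  have inL e : e \in left_letters S (drop i p) -> exists r u,
      [/\ size r = i.-1, trail G x r u & joins G e u z].
    case/left_lettersP=> r rS; have /trail_cat[u xu [w jw wy]] := trS _ rS.
    exists r, u; split=> //; last by rewrite (trail_start_inj zy wy).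
    by have := szS _ rS; rewrite size_cat /= size_drop (szS p pS); lia.
  have inR e : e \in right_letters S (take i p) -> exists r w,
      [/\ size r = (t' - i)%N, trail G w r y & joins G e z w].
    case/right_lettersP=> r rS; have /trail_cat[u xu [w jw wy]] := trS _ rS.
    exists r, w; split=> //; last by rewrite (trail_end_inj xz xu).
    by have := szS _ rS; rewrite size_cat /= size_take (szS p pS); case: ifP; lia.
  rewrite -size_cat; apply: (deg z).
    (* If [e] were both, its other end would be reached from [x] and continued to [y] with t - 2
       edges in all. *)
    rewrite cat_uniq left_letters_uniq right_letters_uniq andbT /=.
    apply/negP => /hasP[e /inR[r [w [szr wy jw]]] /inL[q [u [szq xu ju]]]].
    have wu : w = u by apply: joins_inj jw (joins_sym ju).
    have /min_t : trail G x (q ++ r) y by apply/trail_cat; exists u; rewrite // -wu.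
    by rewrite size_cat; lia.
  move=> e; rewrite mem_cat => /orP[/inL[_ [u [_ _ ju]]]|/inR[_ [w [_ _ jw]]]].
    exact: joins_incident (joins_sym ju).
  exact: joins_incident jw.
- by rewrite mulr_ge0 ?powR_ge0.
(* Squaring makes the exponent the natural number t - 1; for t = 1 both kinds of power give 1, even
   at base 0. *)
rewrite exprMn -[(_ `^ _) ^+ 2]powR_mulrn ?powR_ge0 // -powRrM et.
have -> : (t'.+1%:R - 1) / 2 * 2 = t'%:R :> R.
  by rewrite -natr1 addrK divfK // pnatr_eq0.
by rewrite powR_mulrn ?mulr_ge0 // natrM !natrX natrM.
Qed.
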